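(* Let $Q$ be a network consisting of two nodes joined by an odd number of arcs, and let $L$ be the length of its longest arc. Then the value of the continuous patrolling game on $Q$ with attack duration $\alpha$ is $V=\alpha/\mu$ for all $0<\alpha\le\mu-L$.
   Context: Arcs are open intervals of positive length. $\lambda$ is the length measure, $\mu=\lambda(Q)$ is the total length, and $d$ is the shortest-path metric. The game is as follows. The Patroller picks a patrol $S:[0,\infty)\to Q$ with $d(S(t),S(t'))\le|t-t'|$. The Attacker picks a point $x\in Q$ and a start time $\tau\ge0$. The Patroller wins (payoff $1$) iff $x\in S([\tau,\tau+\alpha])$, and gets $0$ otherwise. $V$ is the value with mixed strategies. *)

(* Defs.v *)
From HB Require Import structures.
From mathcomp Require Import all_boot all_order all_algebra.
From mathcomp Require Import all_classical all_reals all_analysis.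

Set Implicit Arguments.
Unset Strict Implicit.
Unset Printing Implicit Defensive.

Import Order.TTheory GRing.Theory Num.Theory.
Import numFieldNormedType.Exports.

Local Open Scope classical_set_scope.
Local Open Scope ring_scope.

Definition time (R : realType) : Type := {nonneg R}.

HB.instance Definition _ (R : realType) := Choice.on (time R).
HB.instance Definition _ (R : realType) :=
  isPointed.Build (time R) (0%:nng : {nonneg R}).

Definition borel_time (R : realType) :=
  g_sigma_algebra_preimageType (fun t : time R => t%:num : R).

Record network (R : realType) := Network {
  net_node : finType;
  net_arc : finType;
  arc_tail : net_arc -> net_node;
  arc_head : net_arc -> net_node;
  arc_len : net_arc -> R;
  arc_len_gt0 : forall e, 0 < arc_len e;
  card_node_gt0 : (0 < #|net_node|)%N }.

Arguments arc_tail {R n}.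
Arguments arc_head {R n}.
Arguments arc_len {R n}.

Section Network.
Context {R : realType} (Q : network R).

(* The nodes together with the open arcs, the arc [e] being the interval
   ]0, arc_len e[. *)
Definition location : Type :=
  (net_node Q + {e : net_arc Q & {s : R | 0 < s < arc_len e}})%type.

HB.instance Definition _ := Choice.on location.
HB.instance Definition _ :=
  isPointed.Build location (inl (enum_val (Ordinal (card_node_gt0 Q)))).

(* The parametrisation of the closed arc [e] by [0, arc_len e], which is
   constant on either side of this interval. *)
Definition arc_point (e : net_arc Q) (s : R) : location :=
  if s <= 0 then inl (arc_tail e)
  else if (insub s : option {s : R | 0 < s < arc_len e}) is Some u
       then inr (existT _ e u)
       else inl (arc_head e).

(* [path_length x y l]: there is a path of length [l] from [x] to [y]
   made of finitely many monotone moves, each inside one closed arc. *)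
Inductive path_length : location -> location -> R -> Prop :=
| path_length_nil x : path_length x x 0
| path_length_step e s t y l : 0 <= s <= arc_len e -> 0 <= t <= arc_len e ->
    path_length (arc_point e t) y l ->
    path_length (arc_point e s) y (`|t - s| + l).

(* Takes the value +oo exactly when the two points are not connected. *)
Definition net_dist (x y : location) : \bar R :=
  ereal_inf [set l%:E | l in path_length x y].

Definition length_measure (B : set location) : \bar R :=
  \sum_(e : net_arc Q)
    lebesgue_measure [set s : R | (0 < s < arc_len e)%R /\ B (arc_point e s)].

Definition total_length : R := fine (length_measure setT).

Lemma total_lengthE : total_length = \sum_(e : net_arc Q) arc_len e.
Proof.
rewrite /total_length /length_measure.
rewrite (eq_bigr (fun e => (arc_len e)%:E)); first by rewrite sumEFin.
move=> e _.
have -> : [set s : R | 0 < s < arc_len e /\ [set: location] (arc_point e s)]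
  = `]0, arc_len e[%classic.
  by apply/seteqP; split => s /=; rewrite in_itv //= => -[].
by rewrite lebesgue_measure_itv /= lte_fin arc_len_gt0 sube0.
Qed.

Definition longest_arc : R := \big[Num.max/0]_(e : net_arc Q) arc_len e.

Lemma dist_refl x : (net_dist x x <= 0)%E.
Proof. by apply: ereal_inf_lbound; exists 0 => //; exact: path_length_nil. Qed.

Definition dist_open : set (set location) :=
  [set U | forall x, U x ->
     exists2 r : R, 0 < r & forall y, (net_dist x y < r%:E)%E -> U y].

Definition borel_location := g_sigma_algebraType dist_open.

Record patrol := Patrol {
  position :> time R -> location;
  patrol_lipschitz : forall t t' : time R,
    (net_dist (position t) (position t') <= `|t%:num - t'%:num|%:E)%E }.

Definition stay (x : location) : patrol.
Proof.
exists (fun=> x) => t t'.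
by apply: le_trans (dist_refl x) _; rewrite lee_fin.
Defined.

HB.instance Definition _ := gen_eqMixin patrol.
HB.instance Definition _ := gen_choiceMixin patrol.
HB.instance Definition _ := isPointed.Build patrol (stay point).

(* The sigma-algebra generated by the evaluation maps S |-> S t; as Q is
   separable, it is the Borel sigma-algebra of the topology of uniform
   convergence on compact sets. *)
Definition patrol_cylinder : set (set patrol) :=
  [set E | exists (t : time R) (B : set borel_location),
     measurable B /\ E = [set S : patrol | B (S t)]].

Definition patrol_space := g_sigma_algebraType patrol_cylinder.

End Network.

Section Game.
Context {R : realType} (Q : network R) (alpha : R).

Definition attack := (borel_location Q * borel_time R)%type.

Definition intercepts (S : patrol Q) (x : location Q) (tau : time R) : Prop :=
  (S @` [set t | tau%:num <= t%:num <= tau%:num + alpha]) x.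

Definition payoff (S : patrol Q) (x : location Q) (tau : time R) : R :=
  (`[< intercepts S x tau >])%:R.

Definition expected_payoff (P : probability (patrol_space Q) R)
    (A : probability attack R) : \bar R :=
  (\int[P \x A]_z (payoff z.1 z.2.1 z.2.2)%:E)%E.

Definition lower_value : \bar R :=
  ereal_sup (range (fun P => ereal_inf (range (expected_payoff P)))).

Definition upper_value : \bar R :=
  ereal_inf (range (fun A => ereal_sup (range (expected_payoff ^~ A)))).

Definition game_value (V : R) : Prop :=
  lower_value = V%:E /\ upper_value = V%:E.

End Game.

(* Main.v *)
(** Let A and B be the two nodes and mu the total length.  Traverse all the
    arcs, alternately from A to B and from B to A, and then all of them again in
    the same order.  The number of arcs being odd, the second traversal of each
    arc is opposite to the first, so this closed tour of length 2 mu visits each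
    point twice, the two times being at least mu - L >= alpha apart both ways
    round.  Following the tour from a uniformly random starting point therefore
    intercepts every attack with probability at least 2 alpha / (2 mu).

    Conversely, against an attack starting at time 0 at a uniformly random point
    of the tour, a patrol covers a length at most alpha of the network, i.e. a
    set of tour times of measure at most 2 alpha.

    For the expected payoff to be an iterated integral the interception event
    has to be measurable; this is shown by means of finitely many Lipschitz
    coordinates that separate the points of the network. *)

Require Import Defs.
From mathcomp Require Import all_boot all_order all_algebra.
From mathcomp Require Import all_classical all_reals all_analysis.
From mathcomp Require Import measurable_realfun.
From mathcomp Require Import ring lra zify.

Set Implicit Arguments.
Unset Strict Implicit.
Unset Printing Implicit Defensive.

Import Order.TTheory GRing.Theory Num.Theory.
Import numFieldNormedType.Exports.

Local Open Scope classical_set_scope.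
Local Open Scope ring_scope.

(** * Paths, Lipschitz functions and tents on a network *)

Section Paths.
Context {R : realType} (Q : network R).
Implicit Types (x y z : location Q) (e : net_arc Q).

Lemma arc_point0 e : arc_point e 0 = inl (arc_tail e).
Proof. by rewrite /arc_point lexx. Qed.

Lemma arc_point_len e : arc_point e (arc_len e) = inl (arc_head e).
Proof.
rewrite /arc_point leNgt arc_len_gt0 /=.
by case: insubP => //= u; rewrite ltxx andbF.
Qed.

Lemma arc_point_open e (u : {s : R | 0 < s < arc_len e}) :
  arc_point e (sval u) = inr (existT _ e u).
Proof.
rewrite /arc_point; case: u => s hs /=.
have /andP[s0 _] := hs; rewrite leNgt s0 /=.
by rewrite (insubT (fun s => 0 < s < arc_len e) hs).
Qed.

Lemma path_length_arc e s t : 0 <= s <= arc_len e -> 0 <= t <= arc_len e ->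
  path_length (arc_point e s) (arc_point e t) `|t - s|.
Proof.
move=> hs ht; rewrite -[X in path_length _ _ X]addr0.
by apply: path_length_step => //; exact: path_length_nil.
Qed.

Lemma path_length_trans x y z l l' :
  path_length x y l -> path_length y z l' -> path_length x z (l + l').
Proof.
elim=> [w|e s t w k hs ht _ IH] yz; first by rewrite add0r.
by rewrite -addrA; apply: path_length_step => //; exact: IH.
Qed.

Lemma path_length_sym x y l : path_length x y l -> path_length y x l.
Proof.
elim=> [w|e s t w k hs ht _ IH]; first exact: path_length_nil.
by rewrite addrC distrC; apply: path_length_trans IH _; exact: path_length_arc.
Qed.

Lemma net_dist_path x y l : path_length x y l -> (net_dist x y <= l%:E)%E.
Proof. by move=> xy; apply: ereal_inf_lbound; exists l. Qed.

Definition arc_lipschitz (C : R) (f : location Q -> R) :=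
  forall e s t, 0 <= s <= arc_len e -> 0 <= t <= arc_len e ->
  `|f (arc_point e s) - f (arc_point e t)| <= C * `|s - t|.

(** Along a path [f] varies by at most [C] times the length. A violation would make
    [|f x - f y| / C] exceed the distance, hence exceed the length of some path. *)
Lemma arc_lipschitz_dist C f x y r : 0 < C -> arc_lipschitz C f ->
  (net_dist x y <= r%:E)%E -> `|f x - f y| <= C * r.
Proof.
move=> C0 fC xyr; have path_le l : path_length x y l -> `|f x - f y| <= C * l.
  elim=> [w|e s t w k hs ht _ IH]; first by rewrite subrr normr0 mulr0.
  rewrite mulrDr (distrC t); apply: le_trans (lerD (fC e s t hs ht) IH).
  exact: ler_distD.
rewrite leNgt; apply/negP => rlt.
have : (net_dist x y < (`|f x - f y| / C)%:E)%E.
  by apply: le_lt_trans xyr _; rewrite lte_fin ltr_pdivlMr// mulrC.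
move/ereal_inf_lt => [_ [l /path_le lxy] <-].
by rewrite lte_fin ltr_pdivlMr// mulrC ltNge lxy.
Qed.

Definition arc_glue (N : net_node Q -> R) (phi : net_arc Q -> R -> R) x : R :=
  match x with inl v => N v | inr (existT e u) => phi e (sval u) end.

Lemma arc_glueE N phi e s :
  phi e 0 = N (arc_tail e) -> phi e (arc_len e) = N (arc_head e) ->
  0 <= s <= arc_len e -> arc_glue N phi (arc_point e s) = phi e s.
Proof.
move=> phi0 phi1 /andP[]; rewrite le_eqVlt => /predU1P[<- _|s0].
  by rewrite arc_point0 phi0.
rewrite le_eqVlt => /predU1P[->|s1]; first by rewrite arc_point_len phi1.
have hs : 0 < s < arc_len e by rewrite s0.
by have /= -> := arc_point_open (exist _ s hs).
Qed.

Lemma arc_glue_lipschitz C N phi :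
  (forall e, phi e 0 = N (arc_tail e)) ->
  (forall e, phi e (arc_len e) = N (arc_head e)) ->
  (forall e s t, `|phi e s - phi e t| <= C * `|s - t|) ->
  arc_lipschitz C (arc_glue N phi).
Proof. by move=> phi0 phi1 phiC e s t hs ht; rewrite !arc_glueE. Qed.

(** When [r <= s0 <= arc_len e - r] the tent vanishes at both ends of [e], so that it is Lipschitz
    on the whole network and detects points of the open arc. *)
Definition tent e (s0 r : R) : location Q -> R :=
  arc_glue (fun=> 0)
    (fun e' s => if e' == e then Num.max 0 (r - `|s - s0|) else 0).

Lemma tent_ends e s0 r : r <= s0 <= arc_len e - r ->
  Num.max 0 (r - `|0 - s0|) = 0 /\ Num.max 0 (r - `|arc_len e - s0|) = 0.
Proof.
move=> /andP[rs0 s0r]; split; apply/max_idPl.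
  by rewrite subr_le0 sub0r normrN ler_normr rs0.
by rewrite subr_le0 ler_normr lerBrDl -lerBrDr s0r.
Qed.

Lemma tent_lipschitz e s0 r : r <= s0 <= arc_len e - r ->
  arc_lipschitz 1 (tent e s0 r).
Proof.
move=> /tent_ends[tent0 tent1]; apply: arc_glue_lipschitz => [e'|e'|e' s t].
- by case: eqP.
- by case: eqP => // ->.
- case: eqP => _; last by rewrite subrr normr0 mul1r.
  have := ler_distD t s s0; have := ler_distD s t s0.
  rewrite (distrC t s) mul1r => ? ?; rewrite ler_norml /Num.max.
  by case: ltP => ? /=; case: ltP => ? /=; lra.
Qed.

Lemma tent_arc_point e s0 r s : r <= s0 <= arc_len e - r ->
  0 <= s <= arc_len e ->
  tent e s0 r (arc_point e s) = Num.max 0 (r - `|s - s0|).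
Proof.
move=> /tent_ends[tent0 tent1] hs; rewrite /tent arc_glueE ?eqxx //; case: eqP.
Qed.

Lemma tent_gt0 e s0 r y : 0 < tent e s0 r y ->
  exists2 s, 0 < s < arc_len e &
    y = arc_point e s /\ tent e s0 r y = r - `|s - s0|.
Proof.
rewrite /tent; case: y => [v|[e' u]] /=; first by rewrite ltxx.
case: eqP u => [->|_] u; last by rewrite ltxx.
rewrite lt_max ltxx /= => h; exists (sval u); first exact: (svalP u).
by split; [rewrite arc_point_open|apply/max_idPr/ltW].
Qed.

(** The tent at [s] whose radius is the distance to the nearer end has a peak above [rho]. It is
    therefore still positive at [y], which puts [y] on the open arc, and its value there bounds
    [|s - s'|]. *)
Lemma close_to_open_arc e s y rho : rho < s < arc_len e - rho ->
  (net_dist (arc_point e s) y <= rho%:E)%E ->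
  exists2 s', 0 < s' < arc_len e & y = arc_point e s' /\ `|s - s'| <= rho.
Proof.
move=> /andP[rs sr] d; set r := Num.min s (arc_len e - s).
have rho_r : rho < r by rewrite lt_min rs; lra.
have hr : r <= s <= arc_len e - r by rewrite /r /Num.min; case: ltP => ? /=; lra.
have rho0 : 0 <= rho.
  rewrite leNgt; apply/negP => rho0.
  move: d => /(arc_lipschitz_dist ltr01 (tent_lipschitz hr)).
  by rewrite mul1r => /(le_trans (normr_ge0 _)); lra.
have hs : 0 <= s <= arc_len e by lra.
have := arc_lipschitz_dist ltr01 (tent_lipschitz hr) d.
rewrite tent_arc_point// subrr normr0 subr0 mul1r => hd.
have : 0 < tent e s r y.
  by move: hd; rewrite ler_norml /Num.max; case: ltP => ? /=; lra.
move=> /tent_gt0[s' hs' [ys' ty]]; exists s' => //; split => //.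
by move: hd; rewrite ty (distrC s) ler_norml /Num.max; case: ltP => ? /=; lra.
Qed.

End Paths.

(** * Separating coordinates on a network with two nodes *)

Section TwoNodes.
Context {R : realType} (Q : network R).
Hypothesis two_nodes : #|net_node Q| = 2%N.
Hypothesis arcs_join : forall e : net_arc Q, arc_tail e != arc_head e.
Implicit Types (x y z : location Q) (e : net_arc Q).

Definition base_node : net_node Q := enum_val (Ordinal (card_node_gt0 Q)).

(** Two distinct nodes other than the base node would make three. *)
Lemma node_eq v w : (v == base_node) = (w == base_node) -> v = w.
Proof.
case: (v =P base_node) => [-> /esym/eqP //|/eqP vA].
move=> /esym/negbT wA; apply/eqP/negPn/negP => vw.
have /card_uniqP U : uniq [:: base_node; v; w].
  by rewrite /= !inE negb_or !(eq_sym base_node) vA wA vw.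
by have := max_card (mem [:: base_node; v; w]); rewrite U two_nodes.
Qed.

Lemma arc_head_base e : (arc_head e == base_node) = (arc_tail e != base_node).
Proof.
have [tA|tA] := eqVneq (arc_tail e) base_node.
  by have := arcs_join e; rewrite tA eq_sym => /negbTE ->.
apply/negPn/negP => hA; have := arcs_join e.
by rewrite (@node_eq (arc_tail e) (arc_head e)) ?eqxx// (negbTE tA) (negbTE hA).
Qed.

(* [height] and the [bump]s are coordinates: the bumps vanish exactly outside
   their own open arcs, and [height] is injective on each closed arc. *)
Definition height : location Q -> R :=
  arc_glue (fun v => (v != base_node)%:R)
    (fun e s => if arc_tail e == base_node then s / arc_len e
                else 1 - s / arc_len e).

Definition bump e : location Q -> R := tent e (arc_len e / 2) (arc_len e / 2).

(** A measurable substitute for [net_dist]: it is built from finitely many Lipschitz functions and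
    still vanishes only on the diagonal. *)
Definition coord_dist x y : R :=
  `|height x - height y| + \sum_e `|bump e x - bump e y|.

Lemma height_lipschitz :
  exists2 C, 0 < C & arc_lipschitz C height.
Proof.
(* The slope on [e] is [(arc_len e)^-1]; the sum dominates all slopes, and the 1 gives
   positivity. *)
exists (1 + \sum_(e : net_arc Q) (arc_len e)^-1).
  rewrite ltr_pwDl// sumr_ge0// => e _; rewrite invr_ge0 ltW//.
  exact: arc_len_gt0.
have len_neq0 e : arc_len e != 0 by rewrite gt_eqF// arc_len_gt0.
apply: arc_glue_lipschitz => [e|e|e s t].
- by rewrite mul0r; case: eqP; rewrite ?subr0.
- by rewrite divff// arc_head_base negbK; case: eqP; rewrite ?subrr.
- have -> : `|(if arc_tail e == base_node then s / arc_len e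
               else 1 - s / arc_len e)
             - (if arc_tail e == base_node then t / arc_len e
               else 1 - t / arc_len e)| = (arc_len e)^-1 * `|s - t|.
    have /gtr0_norm lenV : 0 < (arc_len e)^-1 by rewrite invr_gt0 arc_len_gt0.
    rewrite -[in RHS]lenV -normrM.
    case: eqP => _; last rewrite -normrN; congr `|_|; ring.
  apply: ler_wpM2r => //; rewrite (bigD1 e)//= addrCA lerDl addr_ge0//.
  rewrite sumr_ge0// => e' _; rewrite invr_ge0 ltW//; exact: arc_len_gt0.
Qed.

Lemma bump_lipschitz e : arc_lipschitz 1 (bump e).
Proof. by apply: tent_lipschitz; lra. Qed.

Lemma coord_dist_lipschitz : exists2 K, 0 < K & forall x y z r,
  (net_dist x y <= r%:E)%E -> coord_dist x z <= coord_dist y z + K * r.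
Proof.
have [C C0 hC] := height_lipschitz.
exists (C + #|net_arc Q|%:R); first by rewrite ltr_pwDl.
move=> x y z r d; rewrite /coord_dist mulrDl addrACA lerD//.
  rewrite -lerBlDl; apply: le_trans (lerB_dist _ _) _.
  by rewrite opprB addrA subrK (arc_lipschitz_dist C0 hC).
have -> : #|net_arc Q|%:R * r = \sum_(e : net_arc Q) r.
  by rewrite sumr_const mulr_natl.
rewrite -big_split ler_sum// => e _.
rewrite -lerBlDl; apply: le_trans (lerB_dist _ _) _.
rewrite opprB addrA subrK -[leRHS]mul1r.
exact: arc_lipschitz_dist (bump_lipschitz e) d.
Qed.

Lemma bump_arc_point e s : 0 < s < arc_len e -> 0 < bump e (arc_point e s).
Proof.
move=> hs; rewrite /bump tent_arc_point; [|lra|lra].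
rewrite lt_max; apply/orP; right; rewrite subr_gt0 ltr_norml; lra.
Qed.

Lemma coord_dist_ge0 x y : 0 <= coord_dist x y.
Proof. by rewrite addr_ge0// sumr_ge0. Qed.

Lemma coord_distxx x : coord_dist x x = 0.
Proof.
rewrite /coord_dist subrr normr0 add0r big1// => e _.
by rewrite subrr normr0.
Qed.

(** A positive bump identifies the open arc containing a point, and a point without one is a node.
    [height] then fixes the position on the arc, or the node. *)
Lemma coord_dist_eq0 x y : coord_dist x y = 0 -> x = y.
Proof.
have sum0 : 0 <= \sum_e `|bump e x - bump e y| by rewrite sumr_ge0.
move=> /eqP; rewrite paddr_eq0// normr_eq0 subr_eq0 => /andP[/eqP hxy].
rewrite psumr_eq0// => /allP bxy.
have {}bxy e : bump e x = bump e y.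
  by have := bxy e; rewrite mem_index_enum normr_eq0 subr_eq0 => /(_ isT)/eqP.
have bump0 e v : bump e (inl v) = 0 by [].
have bump_inr e u : 0 < bump e (inr (existT _ e u)).
  by rewrite -arc_point_open bump_arc_point// (svalP u).
case: x y hxy bxy {sum0} => [v|[e u]] [w|[e' u']].
- move=> /= + _; case: (v =P base_node) => [->|/eqP vA];
    case: (w =P base_node) => [->|/eqP wA] //= /eqP.
  + by rewrite eq_sym oner_eq0.
  + by rewrite oner_eq0.
  + by move=> _; congr inl; apply: node_eq; rewrite (negbTE vA) (negbTE wA).
- by move=> _ /(_ e')/esym; rewrite bump0 => b; have := bump_inr e' u';
    rewrite b ltxx.
- by move=> _ /(_ e); rewrite bump0 => b; have := bump_inr e u; rewrite b ltxx.
- move=> + /(_ e) b; have {b} : 0 < bump e (inr (existT _ e' u')).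
    by rewrite -b.
  rewrite /bump /tent/=; case: eqP => [ee'|]; last by rewrite ltxx.
  move: u'; rewrite ee' => u' _ /= uu'; congr (inr (existT _ e _)).
  apply/val_inj => /=; apply: (mulIf (invr_neq0 (lt0r_neq0 (arc_len_gt0 e)))).
  by move: uu'; case: eqP => _ // /addrI/oppr_inj.
Qed.

End TwoNodes.

(** * The closed tour and its visits *)

Section Tour.
Context {R : realType} (Q : network R).
Hypothesis two_nodes : #|net_node Q| = 2%N.
Hypothesis arcs_join : forall e : net_arc Q, arc_tail e != arc_head e.
Hypothesis odd_arcs : odd #|net_arc Q|.
Implicit Types (x y : location Q) (e : net_arc Q) (k : nat) (t : R).

Let m := #|net_arc Q|.
Let mu := total_length Q.

Lemma card_arc_gt0 : (0 < m)%N.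
Proof. by move: odd_arcs; rewrite -/m; case: m. Qed.

Definition tour_arc k : net_arc Q :=
  enum_val (Ordinal (ltn_pmod k card_arc_gt0)).

Definition tour_time k : R := \sum_(i < k) arc_len (tour_arc i).

(* The [k]-th traversal starts at the base node exactly when [k] is even. *)
Definition forward k : bool := (arc_tail (tour_arc k) == base_node Q) (+) odd k.

Definition tour_coord k t : R :=
  if forward k then t else arc_len (tour_arc k) - t.

Definition traversal k t : location Q :=
  arc_point (tour_arc k) (tour_coord k t).

(** At a joint two indices qualify and [xget] may pick either; [tourE] shows that the choice is
    immaterial. The default 0 is reached only for negative [t]. *)
Definition tour t : location Q :=
  let k := xget 0%N [set k | tour_time k <= t <= tour_time k.+1] in
  traversal k (t - tour_time k).

Lemma tour_arcD k : tour_arc (k + m) = tour_arc k.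
Proof. by congr enum_val; apply/val_inj; rewrite /= modnDr. Qed.

(** A shift by the odd number [m] keeps the arc and flips the parity of the index. *)
Lemma forwardD k : forward (k + m) = ~~ forward k.
Proof. by rewrite /forward tour_arcD oddD odd_arcs addbT addbN. Qed.

Lemma tour_arc_surj e : exists2 k, (k < m)%N & tour_arc k = e.
Proof.
exists (enum_rank e) => //; rewrite -[RHS]enum_rankK; congr enum_val.
by apply/val_inj; rewrite /= modn_small.
Qed.

Lemma tour_arc_inj k j : tour_arc k = tour_arc j -> (k = j %[mod m])%N.
Proof. by move=> /enum_val_inj[]. Qed.

Lemma tour_timeS k : tour_time k.+1 = tour_time k + arc_len (tour_arc k).
Proof. by rewrite /tour_time big_ord_recr. Qed.

Lemma tour_time_lt k j : (k < j)%N -> tour_time k < tour_time j.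
Proof.
elim: j => // j IH; rewrite ltnS leq_eqVlt => /predU1P[->|/IH kj];
  by rewrite tour_timeS ?(lt_trans kj)// ltrDl arc_len_gt0.
Qed.

Lemma tour_time_le k j : (k <= j)%N -> tour_time k <= tour_time j.
Proof. by rewrite leq_eqVlt => /predU1P[->|/tour_time_lt/ltW]. Qed.

Lemma tour_time0 : tour_time 0 = 0.
Proof. by rewrite /tour_time big_ord0. Qed.

Lemma tour_time_total : tour_time m = mu.
Proof.
rewrite /mu total_lengthE /tour_time.
rewrite (reindex_onto (@enum_val (net_arc Q) predT) enum_rank); last first.
  by move=> e _; rewrite enum_rankK.
under [RHS]eq_bigl do rewrite enum_valK eqxx.
apply: eq_bigr => i _; congr arc_len; congr enum_val.
by apply/val_inj; rewrite /= modn_small.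
Qed.

Lemma tour_timeD k : tour_time (k + m) = tour_time k + mu.
Proof.
elim: k => [|k IH]; first by rewrite tour_time0 add0n tour_time_total add0r.
by rewrite addSn !tour_timeS IH tour_arcD addrAC.
Qed.

Lemma total_length_gt0 : 0 < mu.
Proof.
by rewrite -tour_time_total -tour_time0; apply: tour_time_lt card_arc_gt0.
Qed.

Lemma tour_step t : 0 <= t -> exists k, tour_time k <= t <= tour_time k.+1.
Proof.
move=> t0; have [n tn] : exists n, t < tour_time n.
  have timeM j : tour_time (j * m) = mu *+ j.
    by elim: j => [|j IH]; rewrite ?tour_time0// mulSn addnC tour_timeD IH mulrSr.
  exists ((Num.truncn (t / mu)).+1 * m)%N; rewrite timeM -mulr_natl.
  by rewrite -ltr_pdivrMr ?total_length_gt0// truncnS_gt.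
elim: n tn => [|n IH]; first by rewrite tour_time0 ltNge t0.
have [/IH//|nt tn] := ltP t (tour_time n).
by exists n; rewrite nt ltW.
Qed.

(** Both sides are nodes, so it suffices to compare each with the base node. A traversal ends at the
    node opposite to its start, and the parity of the index decides which one that is. *)
Lemma traversal_joint k :
  traversal k (arc_len (tour_arc k)) = traversal k.+1 0.
Proof.
have endE j (b : bool) : arc_point (tour_arc j)
    (if b then arc_len (tour_arc j) else 0) =
    inl (if b then arc_head (tour_arc j) else arc_tail (tour_arc j)).
  by case: b; rewrite ?arc_point_len ?arc_point0.
rewrite /traversal /tour_coord subrr subr0.
have -> : (if forward k.+1 then 0 else arc_len (tour_arc k.+1)) =
   if ~~ forward k.+1 then arc_len (tour_arc k.+1) else 0 by case: forward.
rewrite !endE; congr inl; apply: node_eq => //.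
rewrite /forward /=.
have := arc_head_base two_nodes arcs_join (tour_arc k).
have := arc_head_base two_nodes arcs_join (tour_arc k.+1).
case E1 : (arc_tail (tour_arc k) == _); case E2 : (arc_tail (tour_arc k.+1) == _);
  case: (odd k) => /= h1 h2; rewrite ?h1 ?h2 ?E1 ?E2//.
Qed.

Lemma tourE k t : tour_time k <= t <= tour_time k.+1 ->
  tour t = traversal k (t - tour_time k).
Proof.
move=> kt; rewrite /tour; case: xgetP => [j _ /= jt|/(_ k)//].
(* Distinct indices whose time intervals contain [t] are consecutive, and [t] is their common
   endpoint. *)
have joint i i' : (i < i')%N -> tour_time i <= t <= tour_time i.+1 ->
    tour_time i' <= t <= tour_time i'.+1 ->
    traversal i (t - tour_time i) = traversal i' (t - tour_time i').
  move=> ii' /andP[_ ti] /andP[i't _].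
  have ii'E : i' = i.+1.
    apply/eqP; rewrite eqn_leq ii' andbT leqNgt; apply/negP => /tour_time_lt.
    by rewrite ltNge (le_trans i't).
  have tE : t = tour_time i.+1 by apply/le_anti; rewrite ti -ii'E.
  by rewrite ii'E tE subrr {1}tour_timeS addrAC subrr add0r traversal_joint.
have [jk|kj|->//] := ltngtP j k; first exact: joint.
exact/esym/joint.
Qed.

Lemma tour_coord_le k t : 0 <= t <= arc_len (tour_arc k) ->
  0 <= tour_coord k t <= arc_len (tour_arc k).
Proof. by rewrite /tour_coord; case: forward => ?; lra. Qed.

Lemma tour_coord_dist k s t :
  `|tour_coord k s - tour_coord k t| = `|s - t|.
Proof.
by rewrite /tour_coord; case: forward => //; rewrite -normrN; congr `|_|; ring.
Qed.

Lemma tour_coordK k : involutive (tour_coord k).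
Proof. by move=> t; rewrite /tour_coord; case: forward => //; ring. Qed.

Lemma tour_path t t' : 0 <= t <= t' -> path_length (tour t) (tour t') (t' - t).
Proof.
have arc_path k s s' : tour_time k <= s -> s <= s' -> s' <= tour_time k.+1 ->
    path_length (tour s) (tour s') (s' - s).
  rewrite tour_timeS => ks ss' s'k; rewrite !(@tourE k) ?tour_timeS; [|lra|lra].
  have -> : s' - s = `|tour_coord k (s' - tour_time k)
                       - tour_coord k (s - tour_time k)|.
    by rewrite tour_coord_dist ger0_norm; lra.
  by apply: path_length_arc; apply: tour_coord_le; lra.
move=> /andP[t0 tt']; have [k /andP[kt tk]] := tour_step t0.
have [j /andP[jt' t'j]] := tour_step (le_trans t0 tt').
elim: j t' tt' jt' t'j => [|j IH] t' tt' jt' t'j.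
  by apply: (@arc_path 0) => //; rewrite tour_time0.
(* Either [t] already lies in the last traversal, or the path is cut at the joint
   [tour_time j.+1]. *)
have [jt|tj] := leP (tour_time j.+1) t; first exact: arc_path jt tt' t'j.
rewrite -(subrKA (tour_time j.+1)) addrC.
apply: path_length_trans (IH _ _ _ _) (@arc_path j.+1 _ _ _ _ _) => //.
- exact: ltW.
- exact: tour_time_le.
Qed.

Lemma tour_lipschitz t t' : 0 <= t -> 0 <= t' ->
  (net_dist (tour t) (tour t') <= `|t - t'|%:E)%E.
Proof.
move=> t0 t'0; apply: net_dist_path; have [tt'|/ltW t't] := leP t t'.
  by rewrite distrC ger0_norm ?subr_ge0//; apply: tour_path; rewrite t0.
rewrite ger0_norm ?subr_ge0//; apply: path_length_sym.
by apply: tour_path; rewrite t'0.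
Qed.

(** One round of duration [mu] reverses all directions; the second restores them. *)
Lemma tour_periodic t : 0 <= t -> tour (t + mu *+ 2) = tour t.
Proof.
move=> t0; have [k kt] := tour_step t0.
have timeE j : tour_time (j + m + m) = tour_time j + mu *+ 2.
  by rewrite !tour_timeD mulr2n addrA.
rewrite (tourE kt) (@tourE (k + m + m)%N).
  rewrite timeE opprD addrACA subrr addr0 /traversal /tour_coord !forwardD negbK.
  by rewrite !tour_arcD.
by rewrite -addSn -addSn !timeE !lerD2r.
Qed.

Lemma arc_point_surj x : exists e s, 0 <= s <= arc_len e /\ x = arc_point e s.
Proof.
case: x => [v|[e u]]; last first.
  exists e, (sval u); rewrite arc_point_open; split => //.
  by have /andP[/ltW -> /ltW ->] := svalP u.
pose e := tour_arc 0; have [tv|tv] := eqVneq (arc_tail e) v.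
  by exists e, 0; rewrite lexx ltW ?arc_len_gt0// arc_point0 tv.
exists e, (arc_len e); rewrite lexx ltW ?arc_len_gt0// arc_point_len.
split=> //; congr inl; apply: node_eq => //; rewrite arc_head_base//.
have := contra_neq (@node_eq _ _ two_nodes (arc_tail e) v) tv.
by case: (_ == base_node Q); case: (_ == base_node Q).
Qed.

(* The number of arcs being odd, the two traversals of an arc are in opposite
   directions, so the times between them differ from mu by at most its length. *)
Lemma tour_visits x : exists t t',
  [/\ 0 <= t < mu *+ 2, tour t = x, tour t' = x &
      mu - longest_arc Q <= t' - t <= mu + longest_arc Q].
Proof.
have [e [s [hs ->]]] := arc_point_surj x.
have [k km ke] := tour_arc_surj e.
(* Being an involution, [tour_coord j] also turns the position [s] into the time elapsed since the
   start of traversal [j]. *)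
have visit j : tour_arc j = e ->
    tour_time j <= tour_time j + tour_coord j s <= tour_time j.+1 /\
    tour (tour_time j + tour_coord j s) = arc_point e s.
  move=> je; have : 0 <= tour_coord j s <= arc_len e.
    by rewrite -je tour_coord_le ?je.
  rewrite -je => hj; rewrite (@tourE j) tour_timeS ?lerDl ?lerD2l//.
  by rewrite addrAC subrr add0r /traversal tour_coordK.
have [/andP[ky yk] yE] := visit _ ke.
have ke' : tour_arc (k + m) = e by rewrite tour_arcD.
have [_ y'E] := visit _ ke'.
exists (tour_time k + tour_coord k s), (tour_time (k + m) + tour_coord (k + m) s).
have eL : arc_len e <= longest_arc Q.
  by rewrite /longest_arc; apply: le_bigmax.
split => //.
  rewrite (le_trans _ ky) -?tour_time0 ?tour_time_le//=.
  apply: le_lt_trans yk _; apply: le_lt_trans (tour_time_le km) _.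
  by rewrite tour_time_total mulr2n ltrDl total_length_gt0.
(* The two visits are [mu] apart, up to plus or minus [arc_len e - s *+ 2]. *)
rewrite tour_timeD /tour_coord forwardD ke ke'.
by case: forward => /=; move: hs eL; clear; move=> hs eL; lra.
Qed.

Definition location_arc x : option (net_arc Q) :=
  if x is inr (existT e _) then Some e else None.

Definition location_coord x : R :=
  if x is inr (existT _ u) then sval u else 0.

Lemma open_arc_pointE e s : 0 < s < arc_len e ->
  location_arc (arc_point e s) = Some e /\ location_coord (arc_point e s) = s.
Proof. by move=> hs; have /= -> := arc_point_open (exist _ s hs). Qed.

(** Away from the joints, closeness to [tour a] forces [y] onto the same open arc. The pair consists
    of the times at which the two traversals of that arc meet [y], so it serves all [k] and [a] at
    once. *)
Lemma close_tour_times y rho : exists bb : R * R, forall k a, (k < m + m)%N ->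
  tour_time k + rho < a < tour_time k.+1 - rho ->
  (net_dist (tour a) y <= rho%:E)%E ->
  `|a - bb.1| <= rho \/ `|a - bb.2| <= rho.
Proof.
have close k a : tour_time k + rho < a < tour_time k.+1 - rho ->
    (net_dist (tour a) y <= rho%:E)%E ->
    location_arc y = Some (tour_arc k) /\
    `|a - (tour_time k + tour_coord k (location_coord y))| <= rho.
  rewrite tour_timeS => /andP[ka ak].
  have [rho_ge0|rho_lt0] := leP 0 rho; last first.
    move=> d; exfalso.
    have := arc_lipschitz_dist ltr01 (bump_lipschitz (tour_arc k)) d.
    by rewrite mul1r => /(le_trans (normr_ge0 _)); rewrite leNgt rho_lt0.
  rewrite (@tourE k) ?tour_timeS; last lra.
  move=> /close_to_open_arc[|s hs [-> ]].
    by rewrite /tour_coord; case: forward; lra.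
  have [-> ->] := open_arc_pointE hs; rewrite opprD addrA => d; split=> //.
  by move: d; rewrite -(tour_coord_dist k) tour_coordK.
case ye : (location_arc y) => [e|]; last first.
  (* Here [y] is a node, the premises are contradictory and the pair is arbitrary. *)
  by exists (0, 0) => k a _ ka d; have [] := close k a ka d; rewrite ye.
have [k0 k0m k0e] := tour_arc_surj e.
exists (tour_time k0 + tour_coord k0 (location_coord y),
        tour_time (k0 + m) + tour_coord (k0 + m) (location_coord y)).
move=> k a km ka d; have [] := close k a ka d; rewrite ye => -[] ke.
have /eqP : (k0 = k %[mod m])%N by apply: tour_arc_inj; rewrite k0e.
rewrite (modn_small k0m) => /eqP k0E.
(* Below [m + m] only [k0] and [k0 + m] are traversals of [e]. *)
have [k_m|m_k] := ltnP k m.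
  by rewrite (_ : k0 = k) ?k0E ?modn_small//; left.
suff <- : k = (k0 + m)%N by right.
by rewrite k0E -(subnK m_k) modnDr modn_small// ltn_subLR.
Qed.
End Tour.

(** * Measurability of the interception event *)

Definition abs_time {R : realType} (t : R) : time R := NngNum (normr_ge0 t).

(** One direction is density of the rationals. For the other, [F] attains a minimum on the window,
    and approximate zeros near the window rule out a positive one. Absolute values make every
    rational a legal time. *)
Lemma lipschitz_zero_rat {R : realType} (F : R -> R) (K a alpha : R) :
  0 < K -> 0 <= a -> 0 < alpha -> (forall t, 0 <= F t) ->
  (forall s t, 0 <= s -> 0 <= t -> `|F s - F t| <= K * `|s - t|) ->
  (exists2 t, a <= t <= a + alpha & F t = 0) <->
  (forall n, exists q : rat,
    a - n.+1%:R^-1 <= `|ratr q| <= a + alpha + n.+1%:R^-1 /\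
    F `|ratr q| < n.+1%:R^-1).
Proof.
move=> K0 a0 alpha0 F0 FK; split=> [[t /andP[at_ ta] Ft] n|h].
  set r : R := n.+1%:R^-1; have r0 : 0 < r by rewrite invr_gt0.
  (* A delay below [r / (1 + K)] keeps both the delay and [K] times the delay below [r]. *)
  have d0 : 0 < r / (1 + K) by rewrite divr_gt0// addr_gt0.
  have dE : r / (1 + K) * (1 + K) = r by rewrite divfK// gt_eqF// addr_gt0.
  have Kd : 0 < K * (r / (1 + K)) by rewrite mulr_gt0.
  have tt : t < t + r / (1 + K) by rewrite ltrDl.
  have [q] := rat_in_itvoo tt; rewrite in_itv /= => /andP[tq qt].
  exists q; have q0 : 0 <= ratr q :> R by lra.
  rewrite ger0_norm//; split; first by lra.
  have := FK _ _ q0 (le_trans a0 at_); rewrite Ft subr0 ger0_norm// => /le_lt_trans.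
  apply; rewrite ger0_norm; last by rewrite subr_ge0 ltW.
  have : K * (ratr q - t) < K * (r / (1 + K)) by rewrite ltr_pM2l// ltrBlDl.
  by lra.
pose G (t : R) := F `|t|.
have GK (s t : R) : `|G s - G t| <= K * `|s - t|.
  apply: le_trans (FK _ _ _ _) _ => //; rewrite ler_pM2l//.
  exact: ler_dist_dist.
have contG : continuous G.
  move=> t; apply/cvgrPdist_lt => e e0; apply/nbhs_ballP.
  exists (e / K) => /=; first by rewrite divr_gt0.
  move=> s; rewrite /ball /= ltr_pdivlMr// mulrC => /le_lt_trans; apply.
  exact: GK.
have aalpha : a <= a + alpha by lra.
have [c] := EVT_min aalpha (continuous_subspaceT contG).
rewrite in_itv /= => ac minc; exists c => //.
apply/eqP; rewrite eq_le F0 andbT leNgt; apply/negP => Fc.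
have K1 : 0 < 1 + K by rewrite addr_gt0.
(* The index makes [(1 + K) * r < F c]: moving [|q|] into the window costs at most [K * r] on top of
   a value below [r]. *)
have [q [/andP[aq qa] Fq]] := h (Num.truncn ((1 + K) / F c)).
set r : R := _^-1 in aq qa Fq.
have rK : r * (1 + K) < F c.
  by rewrite mulrC ltr_pdivrMr// mulrC -ltr_pdivrMr// truncnS_gt.
have r0 : 0 < r by rewrite invr_gt0.
have [p ap pq] : exists2 p, a <= p <= a + alpha & `|p - `|ratr q| | <= r.
  have [qa'|aq'] := ltP `|ratr q| a.
    by exists a; [lra|rewrite ler_norml; lra].
  have [qa''|aq''] := leP `|ratr q| (a + alpha).
    by exists `|ratr q|; [lra|rewrite subrr normr0; lra].
  by exists (a + alpha); [lra|rewrite ler_norml; lra].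
have := minc p; rewrite in_itv /= => /(_ ap).
rewrite /G (ger0_norm (_ : 0 <= c)); last by lra.
rewrite (ger0_norm (_ : 0 <= p)); last by lra.
have p0 : 0 <= p by lra.
have := FK _ _ p0 (normr_ge0 (ratr q)).
have : K * `|p - `|ratr q| | <= K * r by rewrite ler_pM2l.
by move=> h1 /le_trans/(_ h1); rewrite ler_norml; lra.
Qed.

Section Measurability.
Context {R : realType} (Q : network R).
Hypothesis two_nodes : #|net_node Q| = 2%N.
Hypothesis arcs_join : forall e : net_arc Q, arc_tail e != arc_head e.
Variable alpha : R.
Hypothesis alpha_gt0 : 0 < alpha.

(** The sets where [f] exceeds [r] are [dist_open]: around [x] a ball of radius [(f x - r) / C] will
    do. *)
Lemma measurable_arc_lipschitz C (f : location Q -> R) : 0 < C ->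
  arc_lipschitz C f -> measurable_fun [set: borel_location Q] f.
Proof.
move=> C0 fC; apply: (measurability _ (RGenOInfty.measurableE R)).
move=> /= _ [_ [r ->] <-]; rewrite setTI; apply: sub_sigma_algebra => x /=.
rewrite in_itv /= andbT => rx; exists ((f x - r) / C).
  by rewrite divr_gt0// subr_gt0.
move=> y xy; rewrite /= in_itv /= andbT ltNge; apply/negP => yr.
have [s sr xys] : exists2 s, s < (f x - r) / C & (net_dist x y <= s%:E)%E.
  have [_ [l xyl <-]] := ereal_inf_lt xy.
  by rewrite lte_fin => lr; exists l => //; exact: net_dist_path.
have := arc_lipschitz_dist C0 fC xys.
rewrite ler_norml; move: sr; rewrite ltr_pdivlMr// => sr; lra.
Qed.

Lemma measurable_eval (t : time R) :
  measurable_fun [set: patrol_space Q] (fun S : patrol Q => S t : borel_location Q).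
Proof.
by move=> _ B mB; rewrite setTI; apply: sub_sigma_algebra; exists t, B.
Qed.

Lemma measurable_time :
  measurable_fun [set: borel_time R] (fun t : time R => t%:num).
Proof. by move=> _ B mB; exists B. Qed.

Lemma measurable_ler_set d (T : measurableType d) (f g : T -> R) :
  measurable_fun setT f -> measurable_fun setT g ->
  measurable [set x | f x <= g x].
Proof.
move=> mf mg; have := measurable_fun_ler mf mg measurableT (Y := [set true]).
by rewrite setTI; apply.
Qed.

Lemma measurable_ltr_set d (T : measurableType d) (f g : T -> R) :
  measurable_fun setT f -> measurable_fun setT g ->
  measurable [set x | f x < g x].
Proof.
move=> mf mg; have := measurable_fun_ltr mf mg measurableT (Y := [set true]).
by rewrite setTI; apply.
Qed.

Lemma measurable_coord_dist d (T : measurableType d)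
    (f g : T -> borel_location Q) :
  measurable_fun setT f -> measurable_fun setT g ->
  measurable_fun setT (fun z => coord_dist (f z) (g z)).
Proof.
move=> mf mg; have mdist (h : location Q -> R) :
    measurable_fun [set: borel_location Q] h ->
    measurable_fun setT (fun z => `|h (f z) - h (g z)|).
  move=> mh; apply: measurableT_comp => //.
  by apply: measurable_funB; exact: measurableT_comp mh _.
apply: measurable_funD.
  have [C C0 hC] := height_lipschitz two_nodes arcs_join.
  by apply: mdist; exact: measurable_arc_lipschitz C0 hC.
apply: measurable_sum => e; apply: mdist.
exact: measurable_arc_lipschitz ltr01 (bump_lipschitz e).
Qed.

Definition interception_set : set (patrol_space Q * attack Q) :=
  [set z | intercepts alpha z.1 z.2.1 z.2.2].

(* By compactness of the time window, an interception amounts to approximate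
   meetings at rational times slightly around the window, which is a countable
   condition. *)
Lemma interceptsP (S : patrol Q) x (tau : time R) : intercepts alpha S x tau <->
  forall n, exists q : rat,
    tau%:num - n.+1%:R^-1 <= `|ratr q| <= tau%:num + alpha + n.+1%:R^-1 /\
    coord_dist (S (abs_time (ratr q))) x < n.+1%:R^-1.
Proof.
have [K K0 dK] := coord_dist_lipschitz two_nodes arcs_join.
pose F (t : R) := coord_dist (S (abs_time t)) x.
have FK s t : 0 <= s -> 0 <= t -> `|F s - F t| <= K * `|s - t|.
  move=> s0 t0; rewrite /F.
  have h u v : 0 <= u -> 0 <= v ->
      coord_dist (S (abs_time u)) x <= coord_dist (S (abs_time v)) x + K * `|u - v|.
    move=> u0 v0; apply: dK; apply: le_trans (patrol_lipschitz _ _ _) _ => /=.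
    by rewrite lee_fin ler_dist_dist.
  by have := h s t s0 t0; have := h t s t0 s0; rewrite (distrC t) ler_norml; lra.
have FE (t : R) : abs_time `|t| = abs_time t.
  by apply/val_inj; rewrite /= normr_id.
have [zero_rat rat_zero] :=
  lipschitz_zero_rat K0 (ge0 tau) alpha_gt0 (fun t => coord_dist_ge0 _ x) FK.
split=> [[t ht tx] n|h].
  have [|q] := zero_rat _ n; last by rewrite FE; exists q.
  exists t%:num => //; rewrite (_ : abs_time t%:num = t) ?tx ?coord_distxx//.
  by apply/val_inj => /=; rewrite ger0_norm.
have [n|t ht Ft] := rat_zero; first by have [q hq] := h n; exists q; rewrite FE.
have t0 : 0 <= t by apply: le_trans (ge0 tau) _; case/andP: ht.
exists (abs_time t) => /=; first by rewrite ger0_norm.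
exact: coord_dist_eq0 Ft.
Qed.

Lemma measurable_interception_set : measurable interception_set.
Proof.
pose E n (q : rat) : set (patrol_space Q * attack Q) :=
  [set z : patrol_space Q * attack Q |
    (z.2.2 : time R)%:num - n.+1%:R^-1 <= `|ratr q|] `&`
  [set z : patrol_space Q * attack Q |
    `|ratr q| <= (z.2.2 : time R)%:num + alpha + n.+1%:R^-1] `&`
  [set z : patrol_space Q * attack Q |
    coord_dist (position z.1 (abs_time (ratr q))) z.2.1 < n.+1%:R^-1].
have -> : interception_set = \bigcap_n \bigcup_q E n q.
  apply/seteqP; split => z /=.
    by move=> /interceptsP h n _; have [q [/andP[? ?] ?]] := h n; exists q.
  move=> h; apply/interceptsP => n; have [q _ [[h1 h2] h3]] := h n I.
  by exists q; rewrite h1 h2.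
apply: bigcapT_measurable => n; apply: bigcupT_measurable_rat => q.
have mtau : measurable_fun setT
    (fun z : patrol_space Q * attack Q => (z.2.2 : time R)%:num).
  apply: (measurableT_comp measurable_time).
  exact: (measurableT_comp measurable_snd measurable_snd).
apply: measurableI; first apply: measurableI.
- by apply: measurable_ler_set => //; exact: measurable_funB.
- by apply: measurable_ler_set => //; do 2 apply: measurable_funD => //.
- apply: measurable_ltr_set => //; apply: measurable_coord_dist.
    exact: (measurableT_comp (measurable_eval _) measurable_fst).
  exact: (measurableT_comp measurable_fst measurable_snd).
Qed.

End Measurability.

(** * Lebesgue measure estimates and image probabilities *)

Section Estimates.
Context {R : realType}.
Local Notation leb := (@lebesgue_measure R).

(** Removing the interval around the first centre leaves a measurable set covered by the other
    centres. *)
Lemma measurable_lebesgue_cover (rho : R) (s : seq R) (D : set R) :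
  measurable D -> 0 <= rho ->
  (forall a, D a -> exists2 b, b \in s & `|a - b| <= rho) ->
  (leb D <= ((size s)%:R * (rho *+ 2))%:E)%E.
Proof.
move=> mD rho0; elim: s D mD => [|b s IH] D mD hD.
  have -> : D = set0 by rewrite -subset0 => a /hD[].
  by rewrite measure0 mul0r.
pose J : set R := `[b - rho, b + rho]%classic.
have mJ : measurable J by exact: measurable_itv.
have mDJ : measurable (D `\` J) by exact: measurableD.
have lebJ : leb J = (rho *+ 2)%:E.
  rewrite /J lebesgue_measure_itv /= lte_fin.
  case: ltP => [_|]; first by rewrite -EFinB; congr EFin; ring.
  by move=> h; congr EFin; lra.
rewrite [size _]/= -add1n natrD mulrDl mul1r EFinD -lebJ.
apply: le_trans (leeD (lexx _) (IH (D `\` J) mDJ _)).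
  apply: (@le_trans _ _ (leb (J `|` (D `\` J)))); last exact: measureU2.
  apply: le_measure; rewrite ?inE//; first exact: measurableU.
  by move=> a Da; have [Ja|nJa] := pselect (J a); [left|right].
move=> a [/hD[c + ac] nJa]; rewrite inE => /predU1P[cb|]; last by exists c.
by case: nJa; rewrite /J /= in_itv /=; move: ac; rewrite cb ler_norml; lra.
Qed.

(** Two disjoint arcs of a circle cut open at one point give at most three intervals. Half-open ones
    stay disjoint when they touch and are empty when degenerate. *)
Lemma lebesgue_ge_three_itv (D : set R) (p0 p1 p2 p3 p4 p5 : R) :
  measurable D ->
  [&& p0 <= p1, p1 <= p2, p2 <= p3, p3 <= p4 & p4 <= p5] ->
  (forall a, [|| p0 <= a < p1, p2 <= a < p3 | p4 <= a < p5] -> D a) ->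
  ((p1 - p0 + (p3 - p2) + (p5 - p4))%:E <= leb D)%E.
Proof.
move=> mD /and5P[h1 h2 h3 h4 h5] hD.
have lebI (p q : R) : p <= q -> leb `[p, q[%classic = (q - p)%:E.
  rewrite lebesgue_measure_itv /= lte_fin; case: ltP => // qp pq.
  by congr EFin; lra.
rewrite (EFinD (p1 - p0 + (p3 - p2))) (EFinD (p1 - p0)).
rewrite -(lebI _ _ h1) -(lebI _ _ h3) -(lebI _ _ h5).
have m1 : measurable (`[p0, p1[%classic : set R) by exact: measurable_itv.
have m2 : measurable (`[p2, p3[%classic : set R) by exact: measurable_itv.
have m3 : measurable (`[p4, p5[%classic : set R) by exact: measurable_itv.
rewrite -measureU//; last first.
  by apply/seteqP; split => // a [] /=; rewrite !in_itv /= => ? ?; lra.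
rewrite -measureU//; [|exact: measurableU|]; last first.
  by apply/seteqP; split => // a [[]] /=; rewrite !in_itv /= => ? ?; lra.
apply: le_measure; rewrite ?inE//; first by do ?apply: measurableU.
move=> a /= h; apply: hD; move: h; rewrite !in_itv /=.
by move=> [[]|] ->; rewrite ?orbT.
Qed.

(* Two disjoint arcs of length [alpha] of a circle of length [M], seen from
   the fundamental domain [0, M]. *)
Lemma lebesgue_ge_wrap (D : set R) (M alpha c c' : R) :
  measurable D -> 0 < alpha -> 0 <= c <= M ->
  c + alpha <= c' -> c' + alpha <= c + M ->
  (forall a, 0 <= a <= M -> [|| c <= a <= c + alpha, c' <= a <= c' + alpha,
    c <= a + M <= c + alpha | c' <= a + M <= c' + alpha] -> D a) ->
  ((alpha *+ 2)%:E <= leb D)%E.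
Proof.
move=> mD alpha0 /andP[c0 cM] cc' c'c hD.
have three p0 p1 p2 p3 p4 p5 :
    alpha *+ 2 = p1 - p0 + (p3 - p2) + (p5 - p4) ->
    [&& p0 <= p1, p1 <= p2, p2 <= p3, p3 <= p4 & p4 <= p5] ->
    (forall a, [|| p0 <= a < p1, p2 <= a < p3 | p4 <= a < p5] ->
      0 <= a <= M /\ [|| c <= a <= c + alpha, c' <= a <= c' + alpha,
      c <= a + M <= c + alpha | c' <= a + M <= c' + alpha]) ->
    ((alpha *+ 2)%:E <= leb D)%E.
  move=> -> ps pD; apply: lebesgue_ge_three_itv => // a /pD[a0M ha].
  exact: hD.
(* The four cases locate the cut [M]: after both arcs, inside the second, between the two, inside
   the first. *)
have [h1|h1] := leP (c' + alpha) M.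
  apply: (three c (c + alpha) c' (c' + alpha) (c' + alpha) (c' + alpha)).
  - ring.
  - lra.
  - by move=> a ha; split; lra.
have [h2|h2] := leP c' M.
  apply: (three 0 (c' + alpha - M) c (c + alpha) c' M).
  - ring.
  - lra.
  - by move=> a ha; split; lra.
have [h3|h3] := leP (c + alpha) M.
  apply: (three (c' - M) (c' + alpha - M) c (c + alpha) (c + alpha) (c + alpha)).
  - ring.
  - lra.
  - by move=> a ha; split; lra.
apply: (three 0 (c + alpha - M) (c' - M) (c' + alpha - M) c M).
- ring.
- lra.
- by move=> a ha; split; lra.
Qed.

Lemma uniform_prob0E (M : R) (M0 : 0 < M) (D : set R) : measurable D ->
  uniform_prob M0 D = ((M^-1)%:E * leb (D `&` `[0%R, M]%classic))%E.
Proof.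
move=> mD; rewrite /uniform_prob integral_uniform_pdf.
rewrite (eq_integral (cst (M^-1)%:E)).
  by rewrite integral_cst//; apply: measurableI => //; exact: measurable_itv.
move=> a; rewrite inE => -[_ /=]; rewrite in_itv /= => aM.
by rewrite /uniform_pdf aM subr0.
Qed.

Lemma image_probability d d' (T : measurableType d) (T' : measurableType d')
    (P : probability T R) (f : T -> T') : measurable_fun setT f ->
  exists P' : probability T' R, forall A, P' A = P (f @^-1` A).
Proof.
move=> mf; pose X : {mfun T >-> T'} := mfun_Sub (mem_set mf).
by exists (distribution P X).
Qed.

End Estimates.

(** * Optimal strategies and the value *)

Section Value.
Context {R : realType} (Q : network R).
Hypothesis two_nodes : #|net_node Q| = 2%N.
Hypothesis arcs_join : forall e : net_arc Q, arc_tail e != arc_head e.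
Hypothesis odd_arcs : odd #|net_arc Q|.
Variable alpha : R.
Hypothesis alpha_gt0 : 0 < alpha.

Let m := #|net_arc Q|.
Let mu := total_length Q.
Let M := mu *+ 2.

Let ttour : R -> location Q := tour odd_arcs.

Let M_gt0 : 0 < M.
Proof. by rewrite pmulrn_lgt0 ?(total_length_gt0 odd_arcs). Qed.

(** The tour is 1-Lipschitz, so preimages of [dist_open] sets are open. As this holds only from time
    0 on, [|a|] is used to obtain a map on all of [R]. *)
Lemma measurable_tour (t : R) : 0 <= t ->
  measurable_fun setT (fun a : R => ttour (`|a| + t) : borel_location Q).
Proof.
move=> t0; apply: (measurability _ (erefl (@dist_open R Q).-sigma.-measurable)).
move=> _ /= [U oU <-]; rewrite setTI; apply: open_measurable.
rewrite openE => a /= Ua; have [r r0 rU] := oU _ Ua.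
apply/nbhs_ballP; exists r => //= b; rewrite /ball /= => abr; apply: rU.
apply: le_lt_trans (tour_lipschitz _ _ _ _ _) _; rewrite ?addr_ge0//.
rewrite lte_fin; apply: le_lt_trans abr.
by rewrite opprD addrACA subrr addr0 ler_dist_dist.
Qed.

Definition tour_patrol (a : R) : patrol Q.
Proof.
exists (fun t : time R => ttour (`|a| + t%:num)) => t t'.
apply: le_trans (tour_lipschitz _ _ _ _ _) _; rewrite ?addr_ge0//.
by rewrite opprD addrACA subrr add0r.
Defined.

Lemma measurable_tour_patrol :
  measurable_fun setT (tour_patrol : R -> patrol_space Q).
Proof.
apply: (measurability _ (erefl (@patrol_cylinder R Q).-sigma.-measurable)).
move=> _ /= [_ [t [B [mB ->]]] <-].
exact: (measurable_tour (ge0 t)).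
Qed.

Lemma measurable_tour_attack :
  measurable_fun setT (fun a : R => (ttour `|a|, (abs_time 0)) : attack Q).
Proof.
apply: measurable_fun_pair; last exact: measurable_cst.
under eq_fun do rewrite -[`|_|]addr0.
exact: measurable_tour.
Qed.

Lemma payoffE (z : patrol_space Q * attack Q) :
  payoff alpha z.1 z.2.1 z.2.2 = \1_(interception_set alpha) z.
Proof.
rewrite /payoff indicE; congr (nat_of_bool _)%:R.
Qed.

Let mI := measurable_interception_set two_nodes arcs_join alpha_gt0.

(** Tonelli reduces bounds for mixed patrols to bounds for a single patrol against [A]. *)
Lemma expected_payoff_patrol (P : probability (patrol_space Q) R)
    (A : probability (attack Q) R) : expected_payoff alpha P A =
  (\int[P]_S A (xsection (interception_set alpha) S))%E.
Proof.
rewrite /expected_payoff; under eq_integral do rewrite payoffE.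
by rewrite indic_fubini_tonelli1// indic_fubini_tonelli_FE.
Qed.

Lemma expected_payoff_attack (P : probability (patrol_space Q) R)
    (A : probability (attack Q) R) : expected_payoff alpha P A =
  (\int[A]_z P (ysection (interception_set alpha) z))%E.
Proof.
rewrite /expected_payoff; under eq_integral do rewrite payoffE.
by rewrite indic_fubini_tonelli1// indic_fubini_tonelli// indic_fubini_tonelli_GE.
Qed.

Lemma near_midpoint (rho t : R) n : 0 <= t <= n.+1%:R * (rho *+ 2) ->
  exists2 i, (i < n.+1)%N & `|t - (i%:R * (rho *+ 2) + rho)| <= rho.
Proof.
elim: n => [|n IH] /andP[t0 tn].
  by exists 0%N => //; move: tn; rewrite mul0r ler_norml => tn; lra.
have [tn'|tn'] := leP t (n.+1%:R * (rho *+ 2)).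
  by have [|i lin ?] := IH; [rewrite t0|exists i => //; rewrite ltnS ltnW].
exists n.+1 => //; move: tn; rewrite -[n.+2]addn1 natrD mulrDl mul1r => tn.
by rewrite ler_norml; lra.
Qed.

(* Cut the patrol into [n.+1] pieces of duration [rho *+ 2].  Away from the
   joints of the tour, a point of a piece is within [rho] of the midpoint of
   the piece along an arc, hence within [rho] of one of the two tour times of
   that midpoint; the neglected neighbourhoods of the joints shrink as [n]
   grows. *)
Lemma patrol_coverage (S : patrol Q) (D : set R) : measurable D ->
  (forall a, D a -> 0 <= a <= M /\ intercepts alpha S (ttour `|a|) (abs_time 0)) ->
  (lebesgue_measure D <= (alpha *+ 2)%:E)%E.
Proof.
move=> mD hD; apply/lee_addgt0Pr => e e0.
(* Makes the [m.*2.+1] neighbourhoods of the joints, each of length [alpha / n.+1], have total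
   length below [e]. *)
pose n := Num.truncn ((m.*2.+1)%:R * alpha / e).
pose rho := alpha / 2 / n.+1%:R.
have rho0 : 0 <= rho by rewrite !divr_ge0// ltW.
have rhoE : n.+1%:R * (rho *+ 2) = alpha.
  by rewrite /rho -mulr_natr; field; rewrite lt0r_neq0.
have /choice[bb bbP] : forall y, exists bb : R * R, forall k a, (k < m + m)%N ->
  tour_time odd_arcs k + rho < a < tour_time odd_arcs k.+1 - rho ->
  (net_dist (ttour a) y <= rho%:E)%E -> `|a - bb.1| <= rho \/ `|a - bb.2| <= rho.
  by move=> y; exact: close_tour_times.
pose y i := S (abs_time (i%:R * (rho *+ 2) + rho)).
(* The centres of the cover: the joints, then the two tour times attached to each midpoint. *)
pose s := [seq tour_time odd_arcs k | k <- iota 0 (m + m).+1] ++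
  [seq (bb (y i)).1 | i <- iota 0 n.+1] ++ [seq (bb (y i)).2 | i <- iota 0 n.+1].
have joint_in k : (k <= m + m)%N -> tour_time odd_arcs k \in s.
  by move=> km; rewrite mem_cat map_f// mem_iota add0n ltnS.
have cover a : D a -> exists2 b, b \in s & `|a - b| <= rho.
  move=> /hD[/andP[a0 aM]]; rewrite (ger0_norm a0) => -[t /= ht Sta].
  have [k /andP[ka ak]] := tour_step odd_arcs a0.
  (* Since [a <= M], the second case leaves only [a = M], which is the last joint. *)
  have [km|mk] := ltnP k (m + m); last first.
    exists (tour_time odd_arcs (m + m)); first exact: joint_in.
    have -> : a = tour_time odd_arcs (m + m); last by rewrite subrr normr0.
    apply/le_anti; rewrite (le_trans (tour_time_le odd_arcs mk) ka) andbT.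
    by rewrite tour_timeD tour_time_total -mulr2n.
  have [ak'|ka'] := leP a (tour_time odd_arcs k + rho).
    exists (tour_time odd_arcs k); first exact/joint_in/ltnW.
    by rewrite ler_norml; lra.
  have [ka''|ak''] := leP (tour_time odd_arcs k.+1 - rho) a.
    exists (tour_time odd_arcs k.+1); first exact: joint_in.
    by rewrite ler_norml; lra.
  have [|i lin hi] := @near_midpoint rho t%:num n.
    by rewrite rhoE; move: ht; rewrite normr0 add0r.
  have [] := bbP (y i) k a km; rewrite ?ka' ?ak''//.
  - rewrite -Sta; apply: le_trans (patrol_lipschitz _ _ _) _.
    rewrite lee_fin /= (ger0_norm (_ : 0 <= i%:R * (rho *+ 2) + rho))//.
    by rewrite addr_ge0// mulr_ge0// mulrn_wge0.
  - by exists (bb (y i)).1 => //; rewrite !mem_cat (map_f _ (_ : i \in _)) ?orbT//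
      mem_iota.
  - by exists (bb (y i)).2 => //; rewrite !mem_cat (map_f _ (_ : i \in _)) ?orbT//
      mem_iota.
apply: le_trans (measurable_lebesgue_cover mD rho0 cover) _.
rewrite -EFinD lee_fin !size_cat !size_map !size_iota.
have -> : ((m + m).+1 + (n.+1 + n.+1) = m.*2.+1 + n.+1.*2)%N by lia.
rewrite natrD mulrDl -[n.+1.*2]muln2 natrM mulrAC rhoE mulr_natr addrC lerD2l.
have n0 : (0 : R) < n.+1%:R by [].
rewrite -(ler_pM2l n0) mulrCA rhoE mulrC; apply: ltW.
by rewrite mulrC -ltr_pdivrMr// truncnS_gt.
Qed.

Lemma patrol_win_probability (S : patrol Q) :
  (uniform_prob M_gt0
     [set a : R | intercepts alpha S (ttour `|a|) (abs_time 0)] <= (alpha / mu)%:E)%E.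
Proof.
have mS : measurable [set a : R | intercepts alpha S (ttour `|a|) (abs_time 0)].
  have /= := measurable_tour_attack measurableT (measurable_xsection (S : patrol_space Q) mI).
  rewrite setTI; congr measurable; apply/seteqP; split => a /=;
    by rewrite /xsection /= inE.
rewrite uniform_prob0E//.
have -> : alpha / mu = M^-1 * (alpha *+ 2).
  by rewrite /M; field; rewrite lt0r_neq0// (total_length_gt0 odd_arcs).
rewrite EFinM lee_pmul2l//; last by rewrite lte_fin invr_gt0.
apply: (@patrol_coverage S); first exact: measurableI.
by move=> a [aS]; rewrite /= in_itv.
Qed.

Hypothesis alpha_le : alpha <= mu - longest_arc Q.

(** Starting points that catch the attack at visit [t] form the arc from [t - tau - alpha] to
    [t - tau] of a circle of length [M]. The visits [t] and [t'] are at least [alpha] apart both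
    ways round, so their arcs do not overlap. *)
Lemma tour_win_probability (x : location Q) (tau : time R) :
  ((alpha / mu)%:E <= uniform_prob M_gt0
     [set a : R | intercepts alpha (tour_patrol a) x tau])%E.
Proof.
have mS : measurable [set a : R | intercepts alpha (tour_patrol a) x tau].
  have /= := measurable_tour_patrol measurableT
    (measurable_ysection ((x, tau) : attack Q) mI).
  rewrite setTI; congr measurable; apply/seteqP; split => a /=;
    by rewrite /ysection /= inE.
rewrite uniform_prob0E//.
have -> : alpha / mu = M^-1 * (alpha *+ 2).
  by rewrite /M; field; rewrite lt0r_neq0// (total_length_gt0 odd_arcs).
rewrite EFinM lee_pmul2l//; last by rewrite lte_fin invr_gt0.
have [t [t' [/andP[t0 tM] tx t'x tt']]] := tour_visits two_nodes arcs_join odd_arcs x.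
rewrite -/mu -/M in tM tt'; have tau0 : 0 <= tau%:num by exact: ge0.
have alpha0 := alpha_gt0; have alphaL := alpha_le.
have periodic j u : 0 <= u -> ttour (u + M *+ j) = ttour u.
  move=> u0; elim: j => [|j IH]; first by rewrite mulr0n addr0.
  rewrite mulrSr addrA /ttour tour_periodic//.
  by rewrite addr_ge0// mulrn_wge0// ltW.
(* As [t < M], adding whole periods suffices to bring the left end of the first arc into the
   fundamental domain. *)
have [j j0M] : exists j, 0 <= t - tau%:num - alpha + M *+ j <= M.
  have : t - tau%:num - alpha <= M by lra.
  have [w0 wM|w0 _] := leP 0 (t - tau%:num - alpha).
    by exists 0%N; rewrite mulr0n addr0 w0.
  set w := t - tau%:num - alpha in w0 *; exists (Num.truncn (- w / M)).+1.
  have wM0 : 0 <= - w / M by rewrite divr_ge0 ?oppr_ge0 ?ltW.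
  have /andP[] := truncn_itv wM0; rewrite ler_pdivlMr// ltr_pdivrMr//.
  by rewrite -[M *+ _]mulr_natl -addn1 natrD; lra.
have t'0 : 0 <= t' by lra.
have win a u : 0 <= a -> 0 <= u -> ttour u = x ->
    tau%:num <= u - a <= tau%:num + alpha ->
    intercepts alpha (tour_patrol a) x tau.
  move=> a0 u0 ux hu; have ua : 0 <= u - a by lra.
  exists (NngNum ua) => //=.
  by rewrite (ger0_norm a0) addrC subrK.
(* By periodicity, starting at [a + M] amounts to starting at [a]; this accounts for the parts of
   the arcs beyond [M]. *)
have win' a u : 0 <= a -> 0 <= u -> ttour u = x ->
    tau%:num <= u - (a + M) <= tau%:num + alpha ->
    intercepts alpha (tour_patrol a) x tau.
  move=> a0 u0 ux hu; have ua : 0 <= u - (a + M) by lra.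
  exists (NngNum ua) => //=.
  rewrite (ger0_norm a0) -ux -(periodic 1%N _ (addr_ge0 a0 ua)).
  by congr ttour; rewrite mulr1n; ring.
have tjx : ttour (t + M *+ j) = x by rewrite periodic.
have t'jx : ttour (t' + M *+ j) = x by rewrite periodic.
have Mj : 0 <= M *+ j by rewrite mulrn_wge0// ltW.
apply: (@lebesgue_ge_wrap _ _ M alpha (t - tau%:num - alpha + M *+ j)
  (t' - tau%:num - alpha + M *+ j)) => //.
- by apply: measurableI => //; exact: measurable_itv.
- by lra.
- by rewrite /M; lra.
move=> a aM ha; split; last by rewrite /= in_itv.
have a0 : 0 <= a by case/andP: aM.
case/or4P: ha => ha.
- by apply: (win a (t + M *+ j)) => //; lra.
- by apply: (win a (t' + M *+ j)) => //; lra.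
- by apply: (win' a (t + M *+ j)) => //; lra.
- by apply: (win' a (t' + M *+ j)) => //; lra.
Qed.

Lemma tour_game_value : game_value Q alpha (alpha / mu).
Proof.
have [P PE] := image_probability (uniform_prob M_gt0) measurable_tour_patrol.
have [A AE] := image_probability (uniform_prob M_gt0) measurable_tour_attack.
have const_le d (T : measurableType d) (p : probability T R) :
    (\int[p]_x cst (alpha / mu)%:E x = (alpha / mu)%:E)%E.
  by rewrite integral_cst//= probability_setT mule1.
have V0 : (0 <= (alpha / mu)%:E)%E.
  by rewrite lee_fin divr_ge0// ltW// (total_length_gt0 odd_arcs).
have P_wins A' : ((alpha / mu)%:E <= expected_payoff alpha P A')%E.
  rewrite expected_payoff_attack -(const_le _ _ A'); apply: ge0_le_integral => //.
    exact: measurable_fun_ysection.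
  move=> [x tau] _ /=; rewrite PE; apply: le_trans (tour_win_probability x tau) _.
  rewrite le_eqVlt; apply/orP; left; apply/eqP; congr uniform_prob.
  by apply/seteqP; split => a /=; rewrite /ysection /= inE.
have A_holds P' : (expected_payoff alpha P' A <= (alpha / mu)%:E)%E.
  rewrite expected_payoff_patrol -(const_le _ _ P'); apply: ge0_le_integral => //.
    exact: measurable_fun_xsection.
  move=> S _ /=; rewrite AE; apply: le_trans (patrol_win_probability S).
  rewrite le_eqVlt; apply/orP; left; apply/eqP; congr uniform_prob.
  by apply/seteqP; split => a /=; rewrite /xsection /= inE.
(* [A] caps the payoff of every patrol and [P] secures it against every attack, which pins down both
   values. *)
split; apply/le_anti/andP; split.
- apply: ge_ereal_sup => _ [P' _ <-]; apply: ge_ereal_inf.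
  by exists (expected_payoff alpha P' A); [exists A|exact: A_holds].
- apply: le_ereal_sup_tmp; exists (ereal_inf (range (expected_payoff alpha P))).
    by exists P.
  by apply: le_ereal_inf_tmp => _ [A' _ <-]; exact: P_wins.
- apply: ge_ereal_inf.
  exists (ereal_sup (range (expected_payoff alpha ^~ A))); first by exists A.
  by apply: ge_ereal_sup => _ [P' _ <-]; exact: A_holds.
- apply: le_ereal_inf_tmp => _ [A' _ <-]; apply: le_ereal_sup_tmp.
  by exists (expected_payoff alpha P A'); [exists P|exact: P_wins].
Qed.

End Value.

Theorem theorem5 (R : realType) (Q : network R)
    (two_nodes : #|net_node Q| = 2%N)
    (arcs_join : forall e : net_arc Q, arc_tail e != arc_head e)
    (odd_arcs : odd #|net_arc Q|)
    (alpha : R) (alpha_gt0 : 0 < alpha)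
    (alpha_le : alpha <= total_length Q - longest_arc Q) :
  game_value Q alpha (alpha / total_length Q).
Proof. exact: tour_game_value. Qed.
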